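(* With the items numbered so that $d_1\ge\cdots\ge d_n$, the problems Con-Car$(p)$ and Dis-Car$(p)$ can be solved in $O(np^2)$ time, and the problems Con-Car$(p,k)$ and Dis-Car$(p,k)$ can be solved in $O(nk^2p)$ time.
   Context: Let $N=\{1,\ldots,n\}$ be a set of items. An instance consists of non-negative rational vectors $C=(C_1,\ldots,C_n)$ (fixed costs), $\underline c=(\underline c_1,\ldots,\underline c_n)$ (nominal uncertain costs), $d=(d_1,\ldots,d_n)$ (maximal deviations), a positive rational number $\Gamma$ (uncertainty budget), and positive integers $p$ and (where applicable) $k$ with $k\le p\le n$. Decisions are binary vectors $x,y\in\{0,1\}^n$; products such as $Cx$ denote scalar products. Define the feasible sets $$F(p)=\Big\{(x,y): \sum_{i\in N}(x_i+y_i)=p,\ \sum_{i\in N}x_iy_i=0\Big\},$$ $$F(p,k)=\Big\{(x,y): \sum_{i\in N}x_i=p,\ \sum_{i\in N}y_i=p,\ \sum_{i\in N}x_iy_i\ge p-k\Big\}.$$ For a feasible set $F$ (either $F(p)$ or $F(p,k)$), the continuous problem with cardinality budget, Con-Car, is $$\min_{(x,y)\in F}\Big\{Cx+\max_{0\le\delta\le d}\big\{(\underline c+\delta)y: |\{i\in N:\delta_i>0\}|\le\Gamma\big\}\Big\}$$ with $\delta=(\delta_1,\ldots,\delta_n)$ a real vector, and the discrete problem with cardinality budget, Dis-Car, is $$\min_{(x,y)\in F}\Big\{Cx+\max_{\delta_i\in\{0,d_i\},\,i\in N}\big\{(\underline c+\delta)y: |\{i\in N:\delta_i>0\}|\le\Gamma\big\}\Big\}.$$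 Con-Car$(p)$, Dis-Car$(p)$ denote these problems with $F=F(p)$; Con-Car$(p,k)$, Dis-Car$(p,k)$ denote them with $F=F(p,k)$. Solving a problem means computing the optimal value and an optimal $(x,y)$. Running time counts elementary arithmetic operations and comparisons on numbers. *)

(* Defs.v *)
From HB Require Import structures.
From mathcomp Require Import all_boot all_order all_algebra.
From mathcomp Require Import classical_sets reals.

Set Implicit Arguments.
Unset Strict Implicit.
Unset Printing Implicit Defensive.

Import Order.TTheory GRing.Theory Num.Theory.
Local Open Scope ring_scope.

Record instance (n : nat) := Instance {
  fixed_cost : {ffun 'I_n -> rat};
  nominal_cost : {ffun 'I_n -> rat};
  deviation : {ffun 'I_n -> rat};
  budget : rat;
  fixed_cost_ge0 : forall i, 0 <= fixed_cost i;
  nominal_cost_ge0 : forall i, 0 <= nominal_cost i;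
  deviation_ge0 : forall i, 0 <= deviation i;
  budget_gt0 : 0 < budget
}.

Definition sorted_deviations n (I : instance n) : Prop :=
  forall i j : 'I_n, (i <= j)%N -> deviation I j <= deviation I i.

Definition binvec (n : nat) := {ffun 'I_n -> bool}.

Definition feasible_p n (p : nat) : {set binvec n * binvec n} :=
  [set xy : binvec n * binvec n | (\sum_i (xy.1 i + xy.2 i) == p)%N
            && (\sum_i xy.1 i * xy.2 i == 0)%N].

(* The truncated subtraction is exact, since this is used only for k <= p. *)
Definition feasible_pk n (p k : nat) : {set binvec n * binvec n} :=
  [set xy : binvec n * binvec n | [&& (\sum_i xy.1 i == p)%N, (\sum_i xy.2 i == p)%N
              & (p - k <= \sum_i xy.1 i * xy.2 i)%N]].

Section RobustProblems.
Variables (R : realType) (n : nat) (I : instance n).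

Definition within_budget (delta : {ffun 'I_n -> R}) : Prop :=
  #|[pred i | 0 < delta i]|%:R <= budget I.

Definition con_car : set {ffun 'I_n -> R} := fun delta =>
  (forall i, 0 <= delta i <= ratr (deviation I i)) /\ within_budget delta.

Definition dis_car : set {ffun 'I_n -> R} := fun delta =>
  (forall i, delta i = 0 \/ delta i = ratr (deviation I i))
  /\ within_budget delta.

Definition uncertain_cost (y : binvec n) (delta : {ffun 'I_n -> R}) : R :=
  \sum_i (ratr (nominal_cost I i) + delta i) * (y i)%:R.

Definition is_max (A : set R) (m : R) : Prop := A m /\ ubound A m.

(* v = C x + max_{delta in U} (c + delta) y, the maximum being attained. *)
Definition objective (U : set {ffun 'I_n -> R}) (xy : binvec n * binvec n)
    (v : R) : Prop :=
  exists2 w, is_max (image U (uncertain_cost xy.2)) w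
           & v = \sum_i ratr (fixed_cost I i) * (xy.1 i)%:R + w.

Definition optimal (F : {set binvec n * binvec n})
    (U : set {ffun 'I_n -> R}) (xy : binvec n * binvec n) (v : R) : Prop :=
  [/\ xy \in F, objective U xy v
    & forall xy', xy' \in F -> exists2 v', objective U xy' v' & v <= v'].

End RobustProblems.

(* The machine model: a structured random access machine.  A program is a
   fixed piece of syntax, independent of n, p, k and of the data.  It has
   natural-number variables, used as indices and counters, and arrays of
   rationals; every variable, array access, constant, arithmetic operation,
   comparison, assignment and evaluation of a guard costs 1. *)

Inductive iexp :=
  | ICst of nat
  | IVar of nat
  | IAdd of iexp & iexp
  | ISub of iexp & iexp
  | IMul of iexp & iexp.

Inductive qexp :=
  | QCst of rat
  | QGet of nat & iexp
  | QAdd of qexp & qexp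
  | QSub of qexp & qexp
  | QMul of qexp & qexp
  | QDiv of qexp & qexp.

Inductive bexp :=
  | ILe of iexp & iexp
  | QLe of qexp & qexp.

Inductive cmd :=
  | Skip
  | ISet of nat & iexp
  | QSet of nat & iexp & qexp
  | Seq of cmd & cmd
  | If of bexp & cmd & cmd
  | While of bexp & cmd.

Record state := State { var : nat -> nat; arr : nat -> nat -> rat }.

Definition set_var (s : state) (v m : nat) : state :=
  State (fun w => if w == v then m else var s w) (arr s).

Definition set_arr (s : state) (a j : nat) (q : rat) : state :=
  State (var s)
    (fun b l => if (b == a) && (l == j) then q else arr s b l).

Fixpoint ieval (s : state) (e : iexp) : nat :=
  match e with
  | ICst m => m
  | IVar v => var s v
  | IAdd e1 e2 => ieval s e1 + ieval s e2
  | ISub e1 e2 => ieval s e1 - ieval s e2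
  | IMul e1 e2 => ieval s e1 * ieval s e2
  end%N.

Fixpoint qeval (s : state) (e : qexp) : rat :=
  match e with
  | QCst q => q
  | QGet a j => arr s a (ieval s j)
  | QAdd e1 e2 => qeval s e1 + qeval s e2
  | QSub e1 e2 => qeval s e1 - qeval s e2
  | QMul e1 e2 => qeval s e1 * qeval s e2
  | QDiv e1 e2 => qeval s e1 / qeval s e2
  end.

Definition beval (s : state) (b : bexp) : bool :=
  match b with
  | ILe e1 e2 => (ieval s e1 <= ieval s e2)%N
  | QLe e1 e2 => qeval s e1 <= qeval s e2
  end.

Fixpoint icost (e : iexp) : nat :=
  match e with
  | ICst _ | IVar _ => 1
  | IAdd e1 e2 | ISub e1 e2 | IMul e1 e2 => (icost e1 + icost e2).+1
  end%N.

Fixpoint qcost (e : qexp) : nat :=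
  match e with
  | QCst _ => 1
  | QGet _ j => (icost j).+1
  | QAdd e1 e2 | QSub e1 e2 | QMul e1 e2 | QDiv e1 e2 =>
      (qcost e1 + qcost e2).+1
  end%N.

Definition bcost (b : bexp) : nat :=
  match b with
  | ILe e1 e2 => (icost e1 + icost e2).+1
  | QLe e1 e2 => (qcost e1 + qcost e2).+1
  end%N.

(* exec c s t s': started in s, the command c halts in s' after time t. *)
Inductive exec : cmd -> state -> nat -> state -> Prop :=
  | ESkip s : exec Skip s 1 s
  | EISet s v e :
      exec (ISet v e) s (icost e).+1 (set_var s v (ieval s e))
  | EQSet s a j e :
      exec (QSet a j e) s (icost j + qcost e).+1
        (set_arr s a (ieval s j) (qeval s e))
  | ESeq s c1 t1 s1 c2 t2 s2 :
      exec c1 s t1 s1 -> exec c2 s1 t2 s2 ->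
      exec (Seq c1 c2) s (t1 + t2)%N s2
  | EIfTrue s b c1 c2 t s' :
      beval s b -> exec c1 s t s' ->
      exec (If b c1 c2) s ((bcost b).+1 + t)%N s'
  | EIfFalse s b c1 c2 t s' :
      ~~ beval s b -> exec c2 s t s' ->
      exec (If b c1 c2) s ((bcost b).+1 + t)%N s'
  | EWhileFalse s b c :
      ~~ beval s b -> exec (While b c) s (bcost b).+1 s
  | EWhileTrue s b c t1 s1 t2 s2 :
      beval s b -> exec c s t1 s1 -> exec (While b c) s1 t2 s2 ->
      exec (While b c) s ((bcost b).+1 + t1 + t2)%N s2.

(* exec is functional, so that "the running time" makes sense. *)
Lemma exec_det c s t1 s1 t2 s2 :
  exec c s t1 s1 -> exec c s t2 s2 -> t1 = t2 /\ s1 = s2.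
Proof.
move=> E1; elim: E1 t2 s2 => {c s t1 s1}.
- by move=> s t2 s2 E; inversion E.
- by move=> s v e t2 s2 E; inversion E.
- by move=> s a j e t2 s2 E; inversion E.
- move=> s c1 ta sa c2 tb sb _ IH1 _ IH2 t2 s2 E; inversion E; subst.
  by do 2 match goal with
    | IH : forall t u, exec ?c ?s t u -> _, H : exec ?c ?s _ _ |- _ =>
      case: (IH _ _ H) => ? ?; subst; clear IH
    end.
- move=> s b c1 c2 t s' bT _ IH t2 s2 E; inversion E; subst.
    by match goal with H : exec c1 _ _ _ |- _ => case: (IH _ _ H) => -> -> end.
  by match goal with H : is_true (~~ _) |- _ => rewrite bT in H end.
- move=> s b c1 c2 t s' bF _ IH t2 s2 E; inversion E; subst.
    by exfalso; apply: (negP bF).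
  by match goal with H : exec c2 _ _ _ |- _ => case: (IH _ _ H) => -> -> end.
- move=> s b c bF t2 s2 E; inversion E; subst => //.
  by exfalso; apply: (negP bF).
move=> s b c ta sa tb sb bT _ IH1 _ IH2 t2 s2 E; inversion E; subst.
  by match goal with H : is_true (~~ _) |- _ => rewrite bT in H end.
by do 2 match goal with
  | IH : forall t u, exec ?c ?s t u -> _, H : exec ?c ?s _ _ |- _ =>
    case: (IH _ _ H) => ? ?; subst; clear IH
  end.
Qed.

Definition arr_fixed : nat := 0.
Definition arr_nominal : nat := 1.
Definition arr_deviation : nat := 2.
Definition arr_budget : nat := 3.
Definition arr_x : nat := 4.
Definition arr_y : nat := 5.
Definition arr_value : nat := 6.

(* Item i of 'I_n sits in cell i, hence items are numbered from 0. *)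
Definition cells n (f : {ffun 'I_n -> rat}) (j : nat) : rat :=
  if insub j is Some i then f i else 0.

(* Variable 0 holds n, the following ones hold the parameters (p, or p and
   then k); everything that is not input is 0. *)
Definition input n (I : instance n) (params : seq nat) : state :=
  State (nth 0%N (n :: params))
    (fun a j =>
       if a == arr_fixed then cells (fixed_cost I) j
       else if a == arr_nominal then cells (nominal_cost I) j
       else if a == arr_deviation then cells (deviation I) j
       else if (a == arr_budget) && (j == 0%N) then budget I
       else 0).

Definition outputs n (s : state) (xy : binvec n * binvec n) (v : rat) : Prop :=
  [/\ forall i : 'I_n, arr s arr_x i = (xy.1 i)%:R,
      forall i : 'I_n, arr s arr_y i = (xy.2 i)%:R
    & arr s arr_value 0 = v].

Definition solves_within (R : realType) n (P : cmd) (I : instance n)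
    (params : seq nat) (F : {set binvec n * binvec n})
    (U : set {ffun 'I_n -> R}) (T : nat) : Prop :=
  exists t s xy v,
    [/\ exec P (input I params) t s, (t <= T)%N, outputs s xy v
      & optimal I F U xy (ratr v)].

Definition solvable_p (R : realType)
    (U : forall n, instance n -> set {ffun 'I_n -> R})
    (time : nat -> nat -> nat) : Prop :=
  exists (P : cmd) (a : nat), forall (n p : nat) (I : instance n),
    (0 < p <= n)%N -> sorted_deviations I ->
    solves_within P I [:: p] (feasible_p n p) (U n I) (a * time n p).

Definition solvable_pk (R : realType)
    (U : forall n, instance n -> set {ffun 'I_n -> R})
    (time : nat -> nat -> nat -> nat) : Prop :=
  exists (P : cmd) (a : nat), forall (n p k : nat) (I : instance n),
    (0 < k)%N -> (k <= p <= n)%N -> sorted_deviations I ->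
    solves_within P I [:: p; k] (feasible_pk n p k) (U n I) (a * time n p k).

(* Main.v *)
Require Import Defs.
From mathcomp Require Import all_boot all_order all_algebra.
From mathcomp Require Import reals.
From mathcomp Require Import classical_sets zify lra.

(* Since the deviations are nonincreasing, against a fixed y an optimal
   adversary attacks the first floor(Gamma) items of y; hence the cost of an
   item depends only on its index, on the way it is used, and on the number t of
   items of y before it.  This makes the problem a shortest path over the states
   (a, b, e) that count the items taken so far in x only, in y only and in both,
   with a, b <= K and e <= L, where (K, L) = (p, 0) for F(p) and (k, p) for
   F(p,k).  A table of the costs to go has O(n K^2 (L + 1)) entries, each
   computed in constant time, and an optimal selection is read off it in one
   forward pass.  Invalid states get a value that exceeds the cost of every
   selection. *)

Set Implicit Arguments.
Unset Strict Implicit.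
Unset Printing Implicit Defensive.

Import Order.TTheory GRing.Theory Num.Theory.
Local Open Scope ring_scope.

(** * Dynamic programming: costs to go, and a greedy forward pass that attains them *)

Section DynamicProgramming.
Variables (n : nat) (C c d : nat -> rat) (Gamma big : rat) (K L : nat).
Variable final : nat * nat * nat -> bool.
Hypothesis C_ge0 : forall i, 0 <= C i.
Hypothesis c_ge0 : forall i, 0 <= c i.
Hypothesis d_ge0 : forall i, 0 <= d i.

(* A state (a, b, e) counts the items taken in x only, in y only and in both. *)
Definition in_box (s : nat * nat * nat) :=
  [&& s.1.1 <= K, s.1.2 <= K & s.2 <= L]%N.

Definition in_y (s : nat * nat * nat) := (s.1.2 + s.2)%N.

Definition advance (s : nat * nat * nat) (z : bool * bool) :=
  (s.1.1 + (z.1 && ~~ z.2), s.1.2 + (~~ z.1 && z.2), s.2 + (z.1 && z.2))%N.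

(* As the deviations are nonincreasing, an item of y with t predecessors in y
   is attacked if and only if t + 1 <= Gamma. *)
Definition robust_cost i t :=
  c i + (if (t.+1)%:R <= Gamma then d i else 0).

Definition item_cost i t (z : bool * bool) :=
  C i * z.1%:R + robust_cost i t * z.2%:R.

(** Here [j] is the number of items still undecided, so the next item to decide is [n - j]. *)
Fixpoint cost_to_go j s : rat :=
  if ~~ in_box s then big else
  if j is j'.+1 then
    let o z := item_cost (n - j) (in_y s) z + cost_to_go j' (advance s z) in
    Num.min (o (true, true)) (Num.min (o (false, true))
      (Num.min (o (true, false)) (o (false, false))))
  else if final s then 0 else big.

Definition option_cost i s z :=
  item_cost i (in_y s) z + cost_to_go (n - i).-1 (advance s z).

(** The value [cost_to_go] is compared with, not recomputed, because the machine reads it off its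
    table. Inside the box it is a lower bound on all four options, so [<=] amounts to equality. *)
Definition choice i s : bool * bool :=
  if option_cost i s (false, false) <= cost_to_go (n - i) s then (false, false)
  else if option_cost i s (true, false) <= cost_to_go (n - i) s
  then (true, false)
  else if option_cost i s (false, true) <= cost_to_go (n - i) s
  then (false, true)
  else (true, true).

Fixpoint state_after (Z : nat -> bool * bool) i :=
  if i is i'.+1 then advance (state_after Z i') (Z i') else (0, 0, 0)%N.

Fixpoint greedy_state i :=
  if i is i'.+1 then advance (greedy_state i') (choice i' (greedy_state i'))
  else (0, 0, 0)%N.

Definition greedy i := choice i (greedy_state i).

Definition total_cost Z i : rat :=
  \sum_(l < i) item_cost l (in_y (state_after Z l)) (Z l).

Lemma state_after_greedy i : state_after greedy i = greedy_state i.
Proof. by elim: i => //= i ->. Qed.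

Lemma robust_cost_ge0 i t : 0 <= robust_cost i t.
Proof. by rewrite addr_ge0 //; case: ifP. Qed.

Lemma item_cost_ge0 i t z : 0 <= item_cost i t z.
Proof. by rewrite addr_ge0 ?mulr_ge0 ?robust_cost_ge0. Qed.

(** This bound is free of the state and of the decision; summed over the items it justifies the size
    of [big]. *)
Lemma item_cost_le i t z : item_cost i t z <= C i + c i + d i.
Proof.
have := C_ge0 i; have := c_ge0 i; have := d_ge0 i.
by case: z => [[] []]; rewrite /item_cost /robust_cost /=; case: ifP => _; lra.
Qed.

Lemma cost_to_go_box j s : cost_to_go j s < big -> in_box s.
Proof. by case: j => [|j] /=; case: (in_box s); rewrite ?ltxx. Qed.

Lemma cost_to_goE i s : (i < n)%N -> in_box s ->
  cost_to_go (n - i) s =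
  Num.min (option_cost i s (true, true)) (Num.min (option_cost i s (false, true))
    (Num.min (option_cost i s (true, false)) (option_cost i s (false, false)))).
Proof.
move=> lt_in s_box; rewrite /option_cost.
case Ej: (n - i)%N => [|j] /=; first by lia.
by rewrite s_box /=; have -> : (n - j.+1 = i)%N by lia.
Qed.

Lemma cost_to_go_le i s z : (i < n)%N -> in_box s ->
  cost_to_go (n - i) s <= option_cost i s z.
Proof.
move=> lt_in s_box; rewrite cost_to_goE // !ge_min.
by case: z => [[] []]; rewrite lexx ?orbT.
Qed.

(** The minimum of four values is attained, so when the first three tests fail the remaining option
    is a minimiser. *)
Lemma option_cost_choice i s : (i < n)%N -> in_box s ->
  option_cost i s (choice i s) = cost_to_go (n - i) s.
Proof.
move=> lt_in s_box; have le_V z := cost_to_go_le z lt_in s_box.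
apply/eqP; rewrite eq_le le_V andbT /choice.
case: ifPn => //; rewrite -ltNge => H00.
case: ifPn => //; rewrite -ltNge => H10.
case: ifPn => //; rewrite -ltNge => H01.
have := cost_to_goE lt_in s_box; rewrite minEle.
case: ifPn => [_ <- //|_ defV].
suff: cost_to_go (n - i) s < cost_to_go (n - i) s by rewrite ltxx.
by rewrite [ltRHS]defV !lt_min H01 H10 H00.
Qed.

(** The three counters never decrease, so a selection that leaves the box cannot return to it. *)
Lemma in_box_state_after Z i :
  (i <= n)%N -> in_box (state_after Z n) -> in_box (state_after Z i).
Proof.
move=> le_in; suff H s z : in_box (advance s z) -> in_box s.
  move: le_in; elim: n => [|m IH]; first by case: i.
  by rewrite leq_eqVlt => /predU1P[->//|/IH H1 /H].
by case/and3P => /= *; apply/and3P; split; lia.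
Qed.

(** The cost of the prefix plus the cost to go never decreases along a selection, and at a final
    state the second summand is 0. *)
Lemma cost_to_go_lower_bound Z :
  in_box (state_after Z n) -> final (state_after Z n) ->
  cost_to_go n (0, 0, 0)%N <= total_cost Z n.
Proof.
move=> Zbox Zfin.
have H i : (i <= n)%N ->
    cost_to_go n (0, 0, 0)%N
    <= total_cost Z i + cost_to_go (n - i) (state_after Z i).
  elim: i => [|i IH] le_in; first by rewrite /total_cost big_ord0 add0r subn0.
  apply: (le_trans (IH (ltnW le_in))).
  rewrite /total_cost big_ord_recr /= -addrA lerD2l.
  have ibox := in_box_state_after (ltnW le_in) Zbox.
  by rewrite (le_trans (cost_to_go_le (Z i) le_in ibox)) // /option_cost subnS.
by have := H n (leqnn n); rewrite subnn /= Zbox Zfin addr0.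
Qed.

Lemma total_cost_ge0 Z i : 0 <= total_cost Z i.
Proof. by apply: sumr_ge0 => l _; apply: item_cost_ge0. Qed.

(** Along the greedy choices the same sum stays constant. The current state is in the box because
    past costs are nonnegative, which keeps its cost to go below [big]. *)
Lemma greedy_invariant i : cost_to_go n (0, 0, 0)%N < big -> (i <= n)%N ->
  total_cost greedy i + cost_to_go (n - i) (greedy_state i)
  = cost_to_go n (0, 0, 0)%N.
Proof.
move=> lt_big; elim: i => [|i IH] le_in.
  by rewrite /total_cost big_ord0 add0r subn0.
have {}IH := IH (ltnW le_in).
have ibox : in_box (greedy_state i).
  apply: (@cost_to_go_box (n - i)); apply: le_lt_trans (lt_big).
  by rewrite -IH lerDr total_cost_ge0.
rewrite /total_cost big_ord_recr /= -/(total_cost _ _) -IH -addrA; congr (_ + _).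
by rewrite -(option_cost_choice le_in ibox) /option_cost subnS state_after_greedy.
Qed.

Lemma greedy_cost_to_go i : cost_to_go n (0, 0, 0)%N < big -> (i <= n)%N ->
  cost_to_go (n - i) (greedy_state i) < big.
Proof.
move=> lt_big le_in; apply: le_lt_trans (lt_big).
by rewrite -(greedy_invariant (i := i)) // ?lerDr ?total_cost_ge0.
Qed.

(** With no items left, a cost to go below [big] can only be the 0 of a final state in the box. *)
Lemma greedy_optimal : cost_to_go n (0, 0, 0)%N < big ->
  [/\ in_box (state_after greedy n), final (state_after greedy n)
    & total_cost greedy n = cost_to_go n (0, 0, 0)%N].
Proof.
move=> lt_big; have := greedy_cost_to_go lt_big (leqnn n).
have := greedy_invariant lt_big (leqnn n).
rewrite subnn state_after_greedy /=.
case: (in_box _) => /=; last by rewrite ltxx.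
by case: (final _); rewrite ?ltxx ?addr0.
Qed.

End DynamicProgramming.

(** * The adversary: attacking the earliest affordable items of y is a worst case *)

Section Adversary.

(* Abel summation: all partial sums of A - S are nonnegative and d is
   nonincreasing; e stands for the next value of d. *)
Lemma prefix_domination (R : realFieldType) (m : nat) (d : nat -> R)
    (A S : nat -> bool) :
  (forall i j, (i <= j)%N -> (j < m)%N -> d j <= d i) ->
  (forall i, 0 <= d i) ->
  (forall i, (i <= m)%N -> (\sum_(l < i) S l <= \sum_(l < i) A l)%N) ->
  \sum_(l < m) d l * (S l)%:R <= \sum_(l < m) d l * (A l)%:R.
Proof.
move=> d_mono d_ge0 dom.
have H i e : (i <= m)%N -> 0 <= e -> (forall l, (l < i)%N -> e <= d l) ->
    ((\sum_(l < i) A l)%N%:R - (\sum_(l < i) S l)%N%:R) * e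
    <= \sum_(l < i) d l * (A l)%:R - \sum_(l < i) d l * (S l)%:R.
  elim: i e => [|i IH] e le_im e_ge0 le_e.
    by rewrite !big_ord0 subrr mul0r.
  have {}IH : _ <= _ := IH (d i) (ltnW le_im) (d_ge0 i)
    (fun l lt_li => d_mono _ _ (ltnW lt_li) le_im).
  have := dom i.+1 le_im; rewrite -(ler_nat R) !big_ord_recr /= !natrD.
  have := le_e i (ltnSn i).
  move: IH; set a := (_%:R in X in (X - _) * _ <= _ -> _).
  set b := (_%:R in X in (_ - X) * _ <= _ -> _).
  move=> IH le_ed dab.
  have : 0 <= (a + (A i)%:R - (b + (S i)%:R)) * (d i - e).
    by rewrite mulr_ge0 // subr_ge0.
  lra.
rewrite -subr_ge0; have := H m 0 (leqnn m) (lexx 0) (fun l _ => d_ge0 l).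
by rewrite mulr0.
Qed.

Variables (n : nat) (I : instance n).

Definition items (xy : binvec n * binvec n) (l : nat) : bool * bool :=
  if insub l is Some i then (xy.1 i, xy.2 i) else (false, false).

Lemma items_ord xy (i : 'I_n) : items xy i = (xy.1 i, xy.2 i).
Proof. by rewrite /items valK. Qed.

Lemma cells_ord (f : {ffun 'I_n -> rat}) (i : 'I_n) : cells f i = f i.
Proof. by rewrite /cells valK. Qed.

Lemma cells_ge0 (f : {ffun 'I_n -> rat}) l :
  (forall i, 0 <= f i) -> 0 <= cells f l.
Proof. by move=> f_ge0; rewrite /cells; case: insub. Qed.

Lemma in_y_advance s z : in_y (advance s z) = (in_y s + z.2)%N.
Proof. by case: z => [[] []]; rewrite /in_y /advance /=; lia. Qed.

Lemma in_y_state_after Z i : in_y (state_after Z i) = (\sum_(l < i) (Z l).2)%N.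
Proof.
by elim: i => [|i IH]; rewrite ?big_ord0 // big_ord_recr /= in_y_advance IH.
Qed.

Lemma card_sum (P : pred 'I_n) : #|P| = (\sum_i P i)%N.
Proof.
rewrite -sum1_card big_mkcond; apply: eq_bigr => i _.
by rewrite unfold_in; case: (P i).
Qed.

(** These are the first floor(Gamma) items of y, described without rounding. *)
Definition attacked Z l := (Z l).2 && ((in_y (state_after Z l)).+1%:R <= budget I).

Lemma attacked_budget Z i : (\sum_(l < i) attacked Z l)%N%:R <= budget I.
Proof.
(* The induction also needs that attacks so far are at most the items of y so far: a new attack then
   brings the count to at most the number tested against the budget. *)
suff [] : (\sum_(l < i) attacked Z l)%N%:R <= budget I
  /\ (\sum_(l < i) attacked Z l <= in_y (state_after Z i))%N by [].
elim: i => [|i [IHb IHt]]; first by rewrite !big_ord0 (ltW (budget_gt0 I)).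
rewrite !big_ord_recr /= in_y_advance {2 4}/attacked.
case: (Z i).2 => /=; last by rewrite !addn0.
case: (boolP (_.+1%:R <= _)) => [H|_] /=; last by rewrite addn0 addn1 leqW.
split; last by rewrite leq_add2r.
by apply: le_trans H; rewrite ler_nat addn1 ltnS.
Qed.

(** An item of y with t predecessors is spared only if Gamma < t + 1. Then w <= t, and the minimum
    has already reached w. *)
Lemma attacked_dominates Z w i : w%:R <= budget I ->
  (minn (in_y (state_after Z i)) w <= \sum_(l < i) attacked Z l)%N.
Proof.
move=> w_le; elim: i => [|i IH]; first by rewrite min0n.
rewrite big_ord_recr /= in_y_advance {2}/attacked.
case: (Z i).2 => /=; last by rewrite !addn0.
move: (bigop _ _ _) IH => m; case: (boolP (_.+1%:R <= _)) => [_|] /=.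
  by lia.
by rewrite -ltNge => /(le_lt_trans w_le); rewrite ltr_nat; lia.
Qed.

Variables (R : realType) (U : set {ffun 'I_n -> R}).
Hypothesis dev_sorted : sorted_deviations I.
(** Both uncertainty sets lie between the discrete and the continuous one. The worst scenario is
    discrete and the upper bound uses only the continuous constraints, so one argument serves
    both. *)
Hypothesis U_con : forall delta, U delta -> con_car I delta.
Hypothesis U_dis : forall delta, dis_car I delta -> U delta.

Definition selection_cost (xy : binvec n * binvec n) : rat :=
  total_cost (cells (fixed_cost I)) (cells (nominal_cost I))
    (cells (deviation I)) (budget I) (items xy) n.

Lemma objective_selection_cost xy : objective I U xy (ratr (selection_cost xy)).
Proof.
pose Z := items xy.
pose rob (i : 'I_n) := ratr (nominal_cost I i) * (xy.2 i)%:R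
  + ratr (deviation I i) * (attacked Z i)%:R : R.
exists (\sum_i rob i); last first.
  rewrite /selection_cost /total_cost rmorph_sum -big_split.
  apply: eq_bigr => i _ /=.
  rewrite /item_cost /robust_cost items_ord !cells_ord /rob /attacked /Z items_ord /=.
  rewrite rmorphD !rmorphM rmorphD /= !ratr_nat; congr (_ + _).
  by case: (xy.2 i); case: ifP => _ /=; rewrite ?rmorph0; lra.
split.
  (* The maximum is attained by the full deviation on the attacked items, a discrete scenario. *)
  exists [ffun i : 'I_n => ratr (deviation I i) * (attacked Z i)%:R].
    apply: U_dis; split=> [i|].
      by rewrite ffunE; case: attacked; rewrite ?mulr1 ?mulr0; [right|left].
    apply: le_trans (attacked_budget Z n); rewrite ler_nat card_sum.
    apply: leq_sum => i _; rewrite inE ffunE.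
    by case: attacked; rewrite ?mulr0 ?ltxx //; case: (_ < _).
  apply: eq_bigr => i _; rewrite ffunE /rob /attacked /Z items_ord /=.
  by case: (xy.2 i) => /=; lra.
move=> _ [delta /U_con[delta_le w_le] <-].
rewrite /uncertain_cost (eq_bigr (fun i => ratr (nominal_cost I i) * (xy.2 i)%:R
  + delta i * (xy.2 i)%:R)); last by move=> i _; rewrite mulrDl.
rewrite !big_split /= lerD2l.
(* Only raised items of y contribute, each by at most its full deviation; this reduces the bound to
   comparing two 0-1 sequences. *)
pose hit l := if insub l is Some i then (0 < delta i) && xy.2 i else false.
have hitE (i : 'I_n) : hit i = (0 < delta i) && xy.2 i by rewrite /hit valK.
apply: (@le_trans _ _ (\sum_(i < n) ratr (cells (deviation I) i) * (hit i)%:R)).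
  apply: ler_sum => i _; rewrite hitE cells_ord; have /andP[de0 dele] := delta_le i.
  case: (xy.2 i); rewrite ?andbF ?mulr0 // andbT mulr1.
  by case: ltP => ? /=; rewrite ?mulr1 ?mulr0.
rewrite [leRHS](eq_bigr (fun i : 'I_n =>
  ratr (cells (deviation I) i) * (attacked Z i)%:R)); last first.
  by move=> i _; rewrite cells_ord.
apply: (@prefix_domination R n (fun l => ratr (cells (deviation I) l)) (attacked Z)
  hit).
- move=> i j le_ij lt_jn; have lt_in := leq_ltn_trans le_ij lt_jn.
  rewrite ler_rat -[i]/(val (Ordinal lt_in)) -[j]/(val (Ordinal lt_jn)) !cells_ord.
  exact: dev_sorted.
- by move=> i; rewrite ler0q cells_ge0 // => l; apply: deviation_ge0.
(* A prefix contains at most as many hits as items of y, and at most as many as there are raised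
   items in total. *)
move=> i le_in; apply: leq_trans (attacked_dominates Z i w_le).
rewrite leq_min in_y_state_after; apply/andP; split.
  apply: leq_sum => l _; have lt_ln := leq_trans (ltn_ord l) le_in.
  rewrite -[val l]/(val (Ordinal lt_ln)) hitE /Z items_ord /=.
  by case: (_ < _); case: (xy.2 _).
rewrite card_sum; apply: (@leq_trans (\sum_(l < n) hit l)%N).
  by rewrite (big_ord_widen _ (fun l => nat_of_bool (hit l)) le_in) big_mkcond;
    apply: leq_sum => l _; case: (_ < _)%N.
by apply: leq_sum => l _; rewrite hitE /=; case: (0 < delta l); case: (xy.2 l).
Qed.

Lemma optimal_selection (F : {set binvec n * binvec n}) xy :
  xy \in F -> (forall xy', xy' \in F -> selection_cost xy <= selection_cost xy') ->
  optimal I F U xy (ratr (selection_cost xy)).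
Proof.
move=> xyF xy_min; split=> //; first exact: objective_selection_cost.
move=> xy' /xy_min le_c; exists (ratr (selection_cost xy')).
  exact: objective_selection_cost.
by rewrite ler_rat.
Qed.

End Adversary.

(** * Loop-free commands as functions on states, and timed total-correctness triples *)

Section StraightLine.

Fixpoint straight (c : cmd) : bool :=
  match c with
  | Seq c1 c2 | If _ c1 c2 => straight c1 && straight c2
  | While _ _ => false
  | _ => true
  end.

(** The value on a loop is a placeholder; [exec_run] relates [run] to execution for [straight]
    commands. *)
Fixpoint run (c : cmd) (s : state) : state :=
  match c with
  | ISet v e => set_var s v (ieval s e)
  | QSet a j e => set_arr s a (ieval s j) (qeval s e)
  | Seq c1 c2 => run c2 (run c1 s)
  | If b c1 c2 => if beval s b then run c1 s else run c2 s
  | Skip | While _ _ => s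
  end.

Fixpoint time_bound (c : cmd) : nat :=
  match c with
  | Skip => 1
  | ISet _ e => (icost e).+1
  | QSet _ j e => (icost j + qcost e).+1
  | Seq c1 c2 => time_bound c1 + time_bound c2
  | If b c1 c2 => (bcost b).+1 + maxn (time_bound c1) (time_bound c2)
  | While b _ => 0
  end.

Lemma exec_run c s : straight c ->
  exists2 t, exec c s t (run c s) & (t <= time_bound c)%N.
Proof.
elim: c s => //=.
- by move=> s _; exists 1%N => //; constructor.
- by move=> v e s _; exists (icost e).+1 => //; constructor.
- by move=> a j e s _; exists (icost j + qcost e).+1 => //; constructor.
- move=> c1 IH1 c2 IH2 s /andP[/(IH1 s)[t1 E1 le1] /(IH2 (run c1 s))[t2 E2 le2]].
  by exists (t1 + t2)%N; [apply: ESeq E1 E2 | apply: leq_add].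
- move=> b c1 IH1 c2 IH2 s /andP[/(IH1 s)[t1 E1 le1] /(IH2 s)[t2 E2 le2]].
  case: ifPn => sb.
    by exists ((bcost b).+1 + t1)%N; [apply: EIfTrue | lia].
  by exists ((bcost b).+1 + t2)%N; [apply: EIfFalse | lia].
Qed.

Definition triple (P : state -> Prop) c T (Q : state -> Prop) :=
  forall s, P s -> exists t s', [/\ exec c s t s', (t <= T)%N & Q s'].

Lemma triple_run P c Q : straight c -> (forall s, P s -> Q (run c s)) ->
  triple P c (time_bound c) Q.
Proof.
move=> c_str PQ s Ps; have [t E le_t] := exec_run s c_str.
by exists t, (run c s); split=> //; apply: PQ.
Qed.

Lemma triple_seq P Q S c1 T1 c2 T2 :
  triple P c1 T1 Q -> triple Q c2 T2 S -> triple P (Seq c1 c2) (T1 + T2) S.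
Proof.
move=> H1 H2 s /H1[t1 [s1 [E1 le1 /H2[t2 [s2 [E2 le2 Ss]]]]]].
by exists (t1 + t2)%N, s2; split=> //; [apply: ESeq E1 E2 | apply: leq_add].
Qed.

(** Indexing the invariant by the iteration number fixes the number of iterations at [N]; the last
    summand of the time pays for the failing guard. *)
Lemma triple_while (inv : nat -> state -> Prop) b c N : straight c ->
  (forall i s, (i < N)%N -> inv i s -> beval s b /\ inv i.+1 (run c s)) ->
  (forall s, inv N s -> ~~ beval s b) ->
  triple (inv 0%N) (While b c)
    (N * ((bcost b).+1 + time_bound c) + (bcost b).+1)%N (inv N).
Proof.
move=> c_str step stop.
(* Here [i] counts the iterations that remain. *)
have H i : (i <= N)%N -> triple (inv (N - i)%N) (While b c)
    (i * ((bcost b).+1 + time_bound c) + (bcost b).+1)%N (inv N).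
  elim: i => [|i IH] le_iN s.
    rewrite subn0 => inv_s; exists (bcost b).+1, s; split=> //.
    by constructor; apply: stop.
  move=> /step[|sb]; first by lia.
  have -> : (N - i.+1).+1 = (N - i)%N by lia.
  move=> /(IH (ltnW le_iN))[t2 [s2 [E2 le2 inv2]]].
  have [t1 E1 le1] := exec_run s c_str.
  exists ((bcost b).+1 + t1 + t2)%N, s2; split=> //.
    by apply: EWhileTrue E1 E2.
  by rewrite mulSn; lia.
by have := H N (leqnn N); rewrite subnn.
Qed.

Lemma run_if b c1 c2 s :
  run (If b c1 c2) s = if beval s b then run c1 s else run c2 s.
Proof. by []. Qed.

Lemma run_seq c1 c2 s : run (Seq c1 c2) s = run c2 (run c1 s).
Proof. by []. Qed.

(** When both branches write to the same cell, the case distinction moves into the stored value and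
    the state keeps a single shape. *)
Lemma run_if_set b a j e1 e2 s :
  run (If b (QSet a j e1) (QSet a j e2)) s
  = set_arr s a (ieval s j) (if beval s b then qeval s e1 else qeval s e2).
Proof. by rewrite /=; case: (beval s b). Qed.

Fixpoint writes_var (v : nat) (c : cmd) : bool :=
  match c with
  | ISet w _ => w == v
  | Seq c1 c2 | If _ c1 c2 => writes_var v c1 || writes_var v c2
  | _ => false
  end.

Fixpoint writes_arr (a : nat) (c : cmd) : bool :=
  match c with
  | QSet b _ _ => b == a
  | Seq c1 c2 | If _ c1 c2 => writes_arr a c1 || writes_arr a c2
  | _ => false
  end.

Lemma run_var v c s : ~~ writes_var v c -> var (run c s) v = var s v.
Proof.
elim: c s => //= [w e s|c1 IH1 c2 IH2 s|b c1 IH1 c2 IH2 s].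
- by rewrite eq_sym => /negbTE->.
- by rewrite negb_or => /andP[w1 w2]; rewrite IH2 // IH1.
- by rewrite negb_or => /andP[w1 w2]; case: ifP => _; rewrite ?IH1 ?IH2.
Qed.

Lemma run_arr a c s j : ~~ writes_arr a c -> arr (run c s) a j = arr s a j.
Proof.
elim: c s => //= [b i e s|c1 IH1 c2 IH2 s|b c1 IH1 c2 IH2 s].
- by rewrite eq_sym => /negbTE->.
- by rewrite negb_or => /andP[w1 w2]; rewrite IH2 // IH1.
- by rewrite negb_or => /andP[w1 w2]; case: ifP => _; rewrite ?IH1 ?IH2.
Qed.

End StraightLine.

(** * The program, parametrised by the box bounds and by an expression that vanishes at final
    states *)

Section Program.
Variables (K_exp L_exp excess : iexp).

(** Variables 1 and 2 hold the input parameters, so the working variables start at 3. *)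
Definition v_n : nat := 0.
Definition v_item : nat := 3.
Definition v_cell : nat := 4.
Definition v_row : nat := 5.
Definition v_a : nat := 6.
Definition v_b : nat := 7.
Definition v_e : nat := 8.
Definition v_stride_b : nat := 9.
Definition v_stride_a : nat := 10.
Definition v_stride_row : nat := 11.
Definition v_iny : nat := 12.
Definition v_K : nat := 13.
Definition v_L : nat := 14.

Definition arr_big : nat := 7.
(* Cell t holds t as a rational: the machine cannot convert a counter. *)
Definition arr_cast : nat := 8.
Definition arr_table : nat := 9.
Definition arr_robust : nat := 10.
Definition arr_best : nat := 11.

Definition at0 a := QGet a (ICst 0).

Definition setup_cmd :=
  Seq (ISet v_K K_exp) (Seq (ISet v_L L_exp)
  (Seq (ISet v_stride_b (IAdd (IVar v_L) (ICst 2)))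
  (Seq (ISet v_stride_a (IMul (IAdd (IVar v_K) (ICst 2)) (IVar v_stride_b)))
  (Seq (ISet v_stride_row (IMul (IAdd (IVar v_K) (ICst 2)) (IVar v_stride_a)))
       (QSet arr_big (ICst 0) (QCst 1)))))).

(** The casts extend beyond n because a state of the box may count up to K + L <= 2n items in y.
    Items beyond the input have cost 0 and add nothing to the big value. *)
Definition cast_guard := ILe (IVar v_item) (IAdd (IVar v_n) (IVar v_n)).

Definition cast_body :=
  Seq (QSet arr_big (ICst 0) (QAdd (at0 arr_big)
    (QAdd (QAdd (QGet arr_fixed (IVar v_item)) (QGet arr_nominal (IVar v_item)))
      (QGet arr_deviation (IVar v_item)))))
  (Seq (QSet arr_cast (IAdd (IVar v_item) (ICst 1))
      (QAdd (QGet arr_cast (IVar v_item)) (QCst 1)))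
    (ISet v_item (IAdd (IVar v_item) (ICst 1)))).

Definition next_cell (z : bool * bool) : iexp :=
  let base := ISub (IVar v_cell) (IVar v_stride_row) in
  match z with
  | (false, false) => base
  | (true, false) => IAdd base (IVar v_stride_a)
  | (false, true) => IAdd base (IVar v_stride_b)
  | (true, true) => IAdd base (ICst 1)
  end.

Definition option_exp (item : iexp) (z : bool * bool) : qexp :=
  QAdd (QAdd (QMul (QGet arr_fixed item) (QCst z.1%:R))
    (QMul (at0 arr_robust) (QCst z.2%:R))) (QGet arr_table (next_cell z)).

Definition robust_cmd (item t : iexp) :=
  If (QLe (QGet arr_cast (IAdd t (ICst 1))) (at0 arr_budget))
    (QSet arr_robust (ICst 0)
      (QAdd (QGet arr_nominal item) (QGet arr_deviation item)))
    (QSet arr_robust (ICst 0) (QAdd (QGet arr_nominal item) (QCst 0))).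

(** The second branch rewrites the old value so that [run_if_set] applies. *)
Definition min_cmd (e : qexp) :=
  If (QLe e (at0 arr_best)) (QSet arr_best (ICst 0) e)
    (QSet arr_best (ICst 0) (at0 arr_best)).

Definition row_item := ISub (IVar v_n) (IVar v_row).

(** Subtraction is truncated, so the sum is 0 exactly when no counter exceeds its bound. *)
Definition box_guard :=
  ILe (IAdd (IAdd (ISub (IVar v_a) (IVar v_K)) (ISub (IVar v_b) (IVar v_K)))
    (ISub (IVar v_e) (IVar v_L))) (ICst 0).

Definition best_big := QSet arr_best (ICst 0) (at0 arr_big).

Definition last_row_cmd :=
  If (ILe excess (ICst 0)) (QSet arr_best (ICst 0) (QCst 0)) best_big.

Definition inner_row_cmd :=
  Seq (robust_cmd row_item (IAdd (IVar v_b) (IVar v_e)))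
  (Seq (QSet arr_best (ICst 0) (option_exp row_item (false, false)))
  (Seq (min_cmd (option_exp row_item (true, false)))
  (Seq (min_cmd (option_exp row_item (false, true)))
       (min_cmd (option_exp row_item (true, true)))))).

Definition cell_cmd :=
  If box_guard
    (If (ILe (IVar v_row) (ICst 0)) last_row_cmd inner_row_cmd) best_big.

(* The nested loops over (row, a, b, e), unrolled into a single odometer. *)
Definition odometer_cmd :=
  Seq (ISet v_cell (IAdd (IVar v_cell) (ICst 1)))
  (Seq (ISet v_e (IAdd (IVar v_e) (ICst 1)))
  (If (ILe (IVar v_e) (IAdd (IVar v_L) (ICst 1))) Skip
    (Seq (ISet v_e (ICst 0)) (Seq (ISet v_b (IAdd (IVar v_b) (ICst 1)))
    (If (ILe (IVar v_b) (IAdd (IVar v_K) (ICst 1))) Skip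
      (Seq (ISet v_b (ICst 0)) (Seq (ISet v_a (IAdd (IVar v_a) (ICst 1)))
      (If (ILe (IVar v_a) (IAdd (IVar v_K) (ICst 1))) Skip
        (Seq (ISet v_a (ICst 0)) (ISet v_row (IAdd (IVar v_row) (ICst 1)))))))))))).

Definition table_guard := ILe (IVar v_row) (IVar v_n).

Definition table_body :=
  Seq cell_cmd
    (Seq (QSet arr_table (IVar v_cell) (at0 arr_best)) odometer_cmd).

(** Row n at state (0, 0, 0) is the start of the path; its entry is the optimal value. *)
Definition rewind_cmd :=
  Seq (ISet v_item (ICst 0)) (Seq (ISet v_iny (ICst 0))
  (Seq (ISet v_cell (IMul (IVar v_n) (IVar v_stride_row)))
    (QSet arr_value (ICst 0) (QGet arr_table (IVar v_cell))))).

Definition trace_guard := ILe (IAdd (IVar v_item) (ICst 1)) (IVar v_n).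

Definition take_cmd (z : bool * bool) :=
  Seq (QSet arr_x (IVar v_item) (QCst z.1%:R))
  (Seq (QSet arr_y (IVar v_item) (QCst z.2%:R))
  (Seq (ISet v_cell (next_cell z))
  (Seq (ISet v_iny (IAdd (IVar v_iny) (ICst z.2)))
       (ISet v_item (IAdd (IVar v_item) (ICst 1)))))).

Definition try_cmd z otherwise :=
  If (QLe (option_exp (IVar v_item) z) (QGet arr_table (IVar v_cell)))
    (take_cmd z) otherwise.

Definition trace_body :=
  Seq (robust_cmd (IVar v_item) (IVar v_iny))
    (try_cmd (false, false) (try_cmd (true, false) (try_cmd (false, true)
      (take_cmd (true, true))))).

Definition program :=
  Seq setup_cmd (Seq (While cast_guard cast_body)
  (Seq (While table_guard table_body)
  (Seq rewind_cmd (While trace_guard trace_body)))).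

(** The 3 comes from 2n + 1 <= 3n. The 54 is 2 * 9 * 3, from n + 1 <= 2n, (K + 2)^2 <= 9 K^2 and L +
    2 <= 3 L, or L + 2 = 2 when L = 0. *)
Definition time_factor :=
  (time_bound setup_cmd
   + 3 * ((bcost cast_guard).+1 + time_bound cast_body) + (bcost cast_guard).+1
   + 54 * ((bcost table_guard).+1 + time_bound table_body)
   + (bcost table_guard).+1 + time_bound rewind_cmd
   + ((bcost trace_guard).+1 + time_bound trace_body) + (bcost trace_guard).+1)%N.

End Program.

(** * Correctness of the program: memory layout and frame conditions *)

Section Verification.
Variables (K_exp L_exp excess : iexp) (n : nat) (params : seq nat) (I : instance n).
Variables (K L : nat) (final : nat * nat * nat -> bool).
Let s0 := input I params.
Let p := nth 0%N params 0.
Let C := cells (fixed_cost I).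
Let c := cells (nominal_cost I).
Let d := cells (deviation I).
Let Gamma := budget I.

Hypothesis K_expP : ieval s0 K_exp = K.
Hypothesis L_expP : ieval (set_var s0 v_K K) L_exp = L.
Hypothesis excessP : forall s, var s 1 = p ->
  (ieval s excess <= 0)%N = final (var s v_a, var s v_b, var s v_e).
Hypothesis KL_le : (K + L <= n + n)%N.

Definition stride_b := (L + 2)%N.
Definition stride_a := ((K + 2) * stride_b)%N.
Definition stride_row := ((K + 2) * stride_a)%N.
(** A mixed-radix numeral with leading digit j and then digits a, b, e in bases K + 2, K + 2, L +
    2. *)
Definition cell j (s : nat * nat * nat) :=
  (j * stride_row + s.1.1 * stride_a + s.1.2 * stride_b + s.2)%N.

Definition big : rat := 1 + \sum_(l < (n + n).+1) (C l + c l + d l).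

Let W := cost_to_go n C c d Gamma big K L final.
Let rob := robust_cost c d Gamma.
Let opt := option_cost n C c d Gamma big K L final.

(* The table has one layer of cells with value big on each side of the box, so
   that successors need no boundary test. *)
Definition padded (s : nat * nat * nat) :=
  [&& s.1.1 < K + 2, s.1.2 < K + 2 & s.2 < L + 2]%N.

Definition configured s :=
  [/\ var s v_n = n, var s 1 = p, var s v_K = K & var s v_L = L] /\
  [/\ var s v_stride_b = stride_b, var s v_stride_a = stride_a
    & var s v_stride_row = stride_row] /\
  [/\ forall l, arr s arr_fixed l = C l, forall l, arr s arr_nominal l = c l,
      forall l, arr s arr_deviation l = d l & arr s arr_budget 0 = Gamma].

Definition ready s :=
  [/\ configured s, arr s arr_big 0 = big
    & forall t, (t <= (n + n).+1)%N -> arr s arr_cast t = t%:R].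

Definition state_of s := (var s v_a, var s v_b, var s v_e).

Definition parameter_vars :=
  [:: v_n; 1%N; v_K; v_L; v_stride_b; v_stride_a; v_stride_row].

Definition instance_arrs :=
  [:: arr_fixed; arr_nominal; arr_deviation; arr_budget].

Lemma configured_run cm s :
  ~~ has (fun v => writes_var v cm) parameter_vars ->
  ~~ has (fun a => writes_arr a cm) instance_arrs ->
  configured s -> configured (run cm s).
Proof.
rewrite -!all_predC /= => /and5P[v1 v2 v3 v4 /and4P[v5 v6 v7 _]] /and5P[a1 a2 a3 a4 _].
case=> [[? ? ? ?] [[? ? ?] [? ? ? ?]]].
by (split; [|split]); split=> *; rewrite ?run_var ?run_arr.
Qed.

Lemma ready_run cm s :
  ~~ has (fun v => writes_var v cm) parameter_vars ->
  ~~ has (fun a => writes_arr a cm)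
     (instance_arrs ++ [:: arr_big; arr_cast]) ->
  ready s -> ready (run cm s).
Proof.
move=> wv wa [conf bigE castE]; move: (wa).
rewrite /= !negb_or => /and5P[a1 a2 a3 a4 /and3P[a5 a6 _]].
split.
- by apply: configured_run conf; rewrite // /= !negb_or a1 a2 a3 a4.
- by rewrite run_arr.
- by move=> t le_t; rewrite run_arr // castE.
Qed.

Lemma ready_set_arr s a j q :
  a \notin instance_arrs ++ [:: arr_big; arr_cast] ->
  ready s -> ready (set_arr s a j q).
Proof.
by move=> a_notin; apply: (@ready_run (QSet a (ICst j) (QCst q))).
Qed.

(** Digits below their bases are determined by the numeral, as one sees by dividing repeatedly. *)
Lemma cell_inj j s j' s' : padded s -> padded s' ->
  cell j s = cell j' s' -> j = j' /\ s = s'.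
Proof.
have digit r x y x' y' : (y < r)%N -> (y' < r)%N ->
    (x * r + y = x' * r + y')%N -> x = x' /\ y = y'.
  move=> y_lt y'_lt E.
  have r_gt0 : (0 < r)%N by lia.
  have Ex : x = x'.
    have := congr1 (divn^~ r) E.
    by rewrite /= !divnMDl // !divn_small // !addn0.
  by split=> //; apply/eqP; rewrite -(eqn_add2l (x * r)) E Ex.
case: s s' => [[a b] e] [[a' b'] e'] /and3P[/= lt_a lt_b lt_e].
case/and3P=> /= lt_a' lt_b' lt_e'.
rewrite /cell /stride_row /stride_a /stride_b /= !mulnA -!mulnDl.
move=> /(digit _ _ _ _ _ lt_e lt_e')[/(digit _ _ _ _ _ lt_b lt_b')[]].
by move=> /(digit _ _ _ _ _ lt_a lt_a')[-> ->] -> ->.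
Qed.

Lemma cell_lt j s j' :
  padded s -> (j <= j')%N -> (cell j s < j'.+1 * stride_row)%N.
Proof.
have digit r x y X : (x < X)%N -> (y < r)%N -> (x * r + y < X * r)%N.
  move=> lt_x lt_y; apply: (@leq_trans (x.+1 * r)); first by rewrite mulSn; lia.
  by rewrite leq_mul2r lt_x orbT.
case: s => [[a b] e] /and3P[/= lt_a lt_b lt_e] le_j.
rewrite /cell /stride_row /stride_a /stride_b /= !mulnA -!mulnDl.
by do 3 apply: (digit) => //.
Qed.

(** * Filling the table in increasing order of cells *)

Definition table_upto s m := forall j t, padded t -> (cell j t < m)%N ->
  arr s arr_table (cell j t) = W j t.

Lemma arr_min_cmd e s : arr (run (min_cmd e) s) arr_best 0 =
  Num.min (qeval s e) (arr s arr_best 0).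
Proof. by rewrite /min_cmd run_if_set minEle. Qed.

Lemma option_exp_min_cmd e s z :
  qeval (run (min_cmd e) s) (option_exp row_item z)
  = qeval s (option_exp row_item z).
Proof. by rewrite /min_cmd run_if_set; case: z => [[] []]. Qed.

Lemma run_robust_cmd item t s : ready s -> (ieval s t <= n + n)%N ->
  run (robust_cmd item t) s =
  set_arr s arr_robust 0 (rob (ieval s item) (ieval s t)).
Proof.
move=> [[_ [_ [_ cE dE gE]]] _ castE] t_le.
rewrite /robust_cmd run_if_set /= cE dE gE castE; last by lia.
by rewrite /rob /robust_cost addn1; case: ifP.
Qed.

Lemma next_cellP z s j t : ready s -> var s v_cell = cell j.+1 t ->
  ieval s (next_cell z) = cell j (advance t z).
Proof.
move=> [[_ [[sb sa sr] _]] _ _].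
case: t z => [[a b] e] [[] []]; rewrite /cell /= => ->;
  rewrite ?sr ?sa ?sb mulSnr; lia.
Qed.

Lemma qeval_option_exp item z s j t : ready s -> (j < n)%N ->
  ieval s item = (n - j.+1)%N -> var s v_cell = cell j.+1 t ->
  in_box K L t -> table_upto s (cell j.+1 t) ->
  arr s arr_robust 0 = rob (n - j.+1) (in_y t) ->
  qeval s (option_exp item z) = opt (n - j.+1) t z.
Proof.
move=> rdy lt_jn itemE cellE t_box tab robE.
have [[_ [[sb sa sr] [CE _ _ _]]] _ _] := rdy.
(* Going back one row outweighs any increase of the counters, so the successor has a smaller cell
   number and is already filled. *)
have sr_gt : (stride_a + stride_b + 1 < stride_row)%N.
  by rewrite /stride_row /stride_a /stride_b; nia.
have next := next_cellP z rdy cellE.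
rewrite /= CE itemE next tab.
- rewrite robE /opt /option_cost; have -> : (n - (n - j.+1)).-1 = j by lia.
  by [].
- case/and3P: t_box => ? ? ?; case: z {next} => [[] []]; apply/and3P;
  split; rewrite /=; lia.
rewrite -next; case: t z {tab robE t_box next} cellE => [[a b] e] [[] []];
  rewrite /cell /= => ->; rewrite ?sr ?sa ?sb; lia.
Qed.

Lemma cell_cmdP s : ready s -> (var s v_row <= n)%N ->
  var s v_cell = cell (var s v_row) (state_of s) ->
  table_upto s (var s v_cell) ->
  arr (run (cell_cmd excess) s) arr_best 0 = W (var s v_row) (state_of s).
Proof.
move=> rdy le_rn cellE tab; case: (rdy) => [[[nE pE KE LE] _] bigE _].
have boxE : (var s v_a - K + (var s v_b - K) + (var s v_e - L) <= 0)%N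
    = in_box K L (state_of s).
  by rewrite leqn0 !addn_eq0 !subn_eq0 -andbA.
have guardE : beval s box_guard = in_box K L (state_of s) by rewrite -boxE -KE -LE.
rewrite /cell_cmd run_if guardE /W.
case: (boolP (in_box K L (state_of s))) => t_box; last first.
  by rewrite [LHS]bigE; case: (var s v_row) => [|j] /=; rewrite (negbTE t_box).
rewrite run_if [beval _ _]/=.
case Er: (var s v_row) cellE tab => [|j] cellE tab.
  rewrite /last_row_cmd run_if [beval _ _]/= excessP // leqnn /= t_box /=.
  by case: (final _) => /=; rewrite ?bigE.
have rowE : ieval s row_item = (n - j.+1)%N by rewrite /= nE Er.
have tE : ieval s (IAdd (IVar v_b) (IVar v_e)) = in_y (state_of s) by [].
rewrite ltn0 /inner_row_cmd 4!run_seq.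
have t_le : (in_y (state_of s) <= n + n)%N.
  by case/and3P: t_box => ? ? ?; apply: leq_trans KL_le; rewrite leq_add.
rewrite run_robust_cmd ?tE //; set s1 := set_arr s arr_robust _ _.
have optE z : qeval s1 (option_exp row_item z) = opt (n - j.+1) (state_of s) z.
  apply: qeval_option_exp => //.
  - by rewrite -Er.
  - by rewrite -cellE.
  - by rewrite -rowE.
rewrite !(arr_min_cmd, option_exp_min_cmd).
set s2 := run _ _; have optE' z : qeval s2 (option_exp row_item z)
    = opt (n - j.+1) (state_of s) z.
  by rewrite -optE; case: z => [[] []].
have -> : arr s2 arr_best 0 = opt (n - j.+1) (state_of s) (false, false).
  by rewrite -optE.
rewrite !optE' -(cost_to_goE C c d Gamma big final _ t_box) //; last by lia.
by congr cost_to_go; lia.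
Qed.

(** Base times stride of a digit is the next stride, so resetting an overflowing digit and carrying
    increases the numeral by exactly 1. *)
Lemma odometer_cmdP s : padded (state_of s) ->
  var s v_L = L -> var s v_K = K ->
  var s v_cell = cell (var s v_row) (state_of s) ->
  let s' := run odometer_cmd s in
  [/\ var s' v_cell = (var s v_cell).+1, padded (state_of s')
    & var s' v_cell = cell (var s' v_row) (state_of s')].
Proof.
case/and3P => lt_a lt_b lt_e LE KE cellE.
rewrite /state_of /odometer_cmd !(run_if, run_seq) /= LE KE.
move: cellE lt_a lt_b lt_e; rewrite /cell /padded /state_of /=.
set a := var s v_a; set b := var s v_b; set e := var s v_e => cellE lt_a lt_b lt_e.
case: (leqP (e + 1)) => [le_e|gt_e] /=; rewrite -/a -/b -/e; last first.
  have eE : (e + 1 = stride_b)%N by rewrite /stride_b; lia.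
  case: (leqP (b + 1)) => [le_b|gt_b] /=; rewrite -/a -/b -/e; last first.
    have bE : ((b + 1) * stride_b = stride_a)%N by rewrite /stride_a; congr muln; lia.
    case: (leqP (a + 1)) => [le_a|gt_a] /=; rewrite -/a -/b -/e; last first.
      have aE : ((a + 1) * stride_a = stride_row)%N.
        by rewrite /stride_row; congr muln; lia.
      split; first by rewrite addn1.
        by apply/and3P; split; lia.
      by rewrite cellE; lia.
    split; first by rewrite addn1.
      by apply/and3P; split; lia.
    by rewrite cellE; lia.
  split; first by rewrite addn1.
    by apply/and3P; split; lia.
  by rewrite cellE; lia.
split; first by rewrite addn1.
  by apply/and3P; split; lia.
by rewrite cellE; lia.
Qed.

Definition sweeping m s :=
  [/\ ready s, var s v_cell = m, padded (state_of s),
      m = cell (var s v_row) (state_of s) & table_upto s m].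

Lemma sweep_step m s : (m < n.+1 * stride_row)%N -> sweeping m s ->
  beval s table_guard /\ sweeping m.+1 (run (table_body excess) s).
Proof.
move=> lt_m [rdy cellE pad mE tab].
(* A row beyond n would start at or after the end of the table. *)
have le_rn : (var s v_row <= n)%N.
  rewrite leqNgt; apply/negP => lt_nr; move: lt_m; rewrite mE /cell.
  have : (n.+1 * stride_row <= var s v_row * stride_row)%N by rewrite leq_mul2r lt_nr orbT.
  by lia.
have [[[nE _ KE LE] _] _ _] := rdy.
split; first by rewrite /= nE.
rewrite /table_body 2!run_seq.
set s1 := run (cell_cmd _) s; set s2 := run (QSet _ _ _) s1.
have var1 v : var s2 v = var s v by rewrite /s2 run_var // run_var.
have st2 : state_of s2 = state_of s by rewrite /state_of !var1.
have := @odometer_cmdP s2; rewrite st2 !var1 cellE.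
move=> /(_ pad LE KE mE)[cellE' pad' cellE2].
have cell1 : var s1 v_cell = m by rewrite run_var.
have tab2 : table_upto s2 m.+1.
  move=> j t pad_t; rewrite ltnS leq_eqVlt /s2 /= => /predU1P[eq_m|lt].
    rewrite cell1 eq_m eqxx cell_cmdP ?cellE //.
    by have [-> ->] := cell_inj pad_t pad (etrans eq_m mE).
  by rewrite cell1 (ltn_eqF lt) run_arr ?tab.
split=> //.
- apply: ready_run => //; apply: ready_run => //; apply: ready_run => //.
- by rewrite -cellE2 cellE'.
by move=> j t pad_t lt; rewrite run_arr ?tab2.
Qed.

Lemma sweep_stop s : sweeping (n.+1 * stride_row)%N s -> ~~ beval s table_guard.
Proof.
move=> [[[[nE _ _ _] _] _ _] _ pad mE _]; rewrite /= nE -ltnNge ltnNge; apply/negP.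
by move=> le_rn; have := cell_lt pad le_rn; rewrite -mE ltnn.
Qed.

(** * Feasibility bounds the optimum, and the first two phases initialise the memory *)

Hypothesis size_params : (size params <= 2)%N.
Hypothesis feasible :
  exists Z, in_box K L (state_after Z n) /\ final (state_after Z n).

Let C_ge0 i : 0 <= C i. Proof. by apply/cells_ge0/fixed_cost_ge0. Qed.
Let c_ge0 i : 0 <= c i. Proof. by apply/cells_ge0/nominal_cost_ge0. Qed.
Let d_ge0 i : 0 <= d i. Proof. by apply/cells_ge0/deviation_ge0. Qed.

(** A feasible selection costs at most the sum of all worst item costs, which is [big] minus 1. *)
Lemma optimum_lt_big : W n (0, 0, 0)%N < big.
Proof.
have [Z [Zbox Zfin]] := feasible.
apply: le_lt_trans (cost_to_go_lower_bound C c d Gamma big Zbox Zfin) _.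
rewrite /big ltr_pwDl //.
rewrite /total_cost (big_ord_widen _ (fun l => item_cost C c d Gamma l
  (in_y (state_after Z l)) (Z l)) (leqW (leq_addr n n))).
rewrite big_mkcond /=; apply: ler_sum => l _.
case: ifP => _; first exact: item_cost_le.
by rewrite !addr_ge0.
Qed.

Definition casting i s :=
  [/\ configured s, var s v_item = i,
      arr s arr_big 0 = 1 + \sum_(l < i) (C l + c l + d l),
      forall t, (t <= i)%N -> arr s arr_cast t = t%:R
    & [/\ var s v_cell = 0%N, var s v_row = 0%N & state_of s = (0, 0, 0)%N]].

Lemma setup_cmdP : casting 0 (run (setup_cmd K_exp L_exp) s0).
Proof.
(* There are at most two parameters, so every working variable initially holds the default 0. *)
have var0 v : (2 < v)%N -> var s0 v = 0%N.
  by case: v => // v lt2v; rewrite /s0 /= nth_default // (leq_trans size_params).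
have E0 : run (ISet v_K K_exp) s0 = set_var s0 v_K K by rewrite /= K_expP.
rewrite /setup_cmd run_seq E0 run_seq [run (ISet v_L _) _]/= L_expP.
split; rewrite ?big_ord0 ?addr0 //.
- by rewrite -[RHS](var0 v_item).
- by case=> // _.
split; rewrite /state_of.
- by rewrite -[RHS](var0 v_cell).
- by rewrite -[RHS](var0 v_row).
by congr (_, _, _); [rewrite -[RHS](var0 v_a) | rewrite -[RHS](var0 v_b)
  | rewrite -[RHS](var0 v_e)].
Qed.

Lemma cast_step i s : (i < (n + n).+1)%N -> casting i s ->
  beval s cast_guard /\ casting i.+1 (run cast_body s).
Proof.
move=> le_i [conf iE bigE castE [cellE rowE stE]].
have [[nE _ _ _] [_ [CE cE dE _]]] := conf.
split; first by rewrite /= iE nE -ltnS.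
split.
- exact: configured_run.
- by rewrite /= iE addn1.
- by rewrite /= iE CE cE dE bigE big_ord_recr /= -[LHS]addrA.
- move=> t; rewrite /= iE addn1 leq_eqVlt => /predU1P[->|lt_t].
    by rewrite eqxx castE // -natr1.
  by rewrite (ltn_eqF lt_t) castE.
- by [].
Qed.

Lemma cast_stop s : casting (n + n).+1 s -> ~~ beval s cast_guard.
Proof. by move=> [[[nE _ _ _] _] iE _ _ _]; rewrite /= iE nE -ltnNge. Qed.

Lemma padded0 : padded (0, 0, 0)%N.
Proof. by rewrite /padded !addn2. Qed.

Lemma casting_sweeping s : casting (n + n).+1 s -> sweeping 0 s.
Proof.
by move=> [conf iE bigE castE [cellE rowE stE]]; split; rewrite ?stE ?rowE ?padded0.
Qed.

(** * Reading an optimal selection off the table *)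

Let st := greedy_state n C c d Gamma big K L final.
Let gr := greedy n C c d Gamma big K L final.

Definition tracing i s :=
  [/\ ready s, [/\ var s v_item = i, var s v_iny = in_y (st i)
      & var s v_cell = cell (n - i) (st i)],
      table_upto s (n.+1 * stride_row)%N,
      forall l, (l < i)%N ->
        arr s arr_x l = (gr l).1%:R /\ arr s arr_y l = (gr l).2%:R
    & arr s arr_value 0 = W n (0, 0, 0)%N].

Lemma rewind_cmdP s : sweeping (n.+1 * stride_row)%N s ->
  tracing 0 (run rewind_cmd s).
Proof.
move=> [rdy _ _ _ tab]; have [[[nE _ _ _] [[_ _ srE] _]] _ _] := rdy.
have cellE : (n * stride_row)%N = cell n (0, 0, 0)%N by rewrite /cell /= !addn0.
split=> //.
- by split; rewrite //= nE srE subn0 cellE.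
by rewrite /= nE srE cellE tab ?cell_lt ?padded0.
Qed.

Lemma trace_step i s : (i < n)%N -> tracing i s ->
  beval s trace_guard /\ tracing i.+1 (run trace_body s).
Proof.
move=> lt_in [rdy [iE yE cellE] tab outE valE].
have [[[nE _ _ _] _] _ _] := rdy.
(* A cost to go below [big] keeps the greedy state in the box, which makes its cell and the required
   cast available. *)
have lt_big := greedy_cost_to_go C_ge0 c_ge0 d_ge0 optimum_lt_big (ltnW lt_in).
have i_box : in_box K L (st i) := cost_to_go_box lt_big.
have le_iny : (ieval s (IVar v_iny) <= n + n)%N.
  rewrite /= yE; case/and3P: i_box => ? ? ?; apply: leq_trans KL_le; exact: leq_add.
have [j Ej] : exists j, (n - i = j.+1)%N by exists (n - i.+1)%N; lia.
have Ei : (n - j.+1 = i)%N by lia.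
split; first by rewrite /= iE nE addn1.
rewrite /trace_body run_seq run_robust_cmd //.
set s1 := set_arr s _ _ _.
have pad_i : padded (st i) by case/and3P: i_box => *; apply/and3P; split; lia.
have lt_cell : (cell (n - i) (st i) < n.+1 * stride_row)%N.
  by apply: cell_lt => //; apply: leq_subr.
have rdy1 : ready s1 by apply: ready_set_arr.
have optE z : qeval s1 (option_exp (IVar v_item) z) = opt i (st i) z.
  rewrite -{1}Ei; apply: qeval_option_exp => //.
  - by lia.
  - by rewrite /= iE Ei.
  - by rewrite -Ej.
  - by move=> j' t pad_t lt_c; apply: tab => //; apply: (ltn_trans lt_c); rewrite -Ej.
  - by rewrite /s1 /= iE yE Ei.
have cellVE : qeval s1 (QGet arr_table (IVar v_cell)) = W (n - i) (st i).
  by rewrite /= cellE tab.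
have leE z : beval s1 (QLe (option_exp (IVar v_item) z)
    (QGet arr_table (IVar v_cell))) = (opt i (st i) z <= W (n - i) (st i)).
  by rewrite -optE -cellVE.
(* The nested tests follow the order of those in [choice], so ties are broken alike. *)
have -> : run (try_cmd (false, false) (try_cmd (true, false) (try_cmd (false, true)
      (take_cmd (true, true))))) s1 = run (take_cmd (gr i)) s1.
  rewrite /try_cmd !run_if !leE /gr /greedy /choice -/st -/opt -/W.
  by case: ifP => // _; case: ifP => // _; case: ifP.
have cellE' z : ieval s1 (next_cell z) = cell (n - i.+1) (advance (st i) z).
  have -> : (n - i.+1 = j)%N by lia.
  by apply: next_cellP => //; rewrite -Ej.
split.
- by apply: ready_run; case: (gr i) => [[] []].
- have -> : st i.+1 = advance (st i) (gr i) by [].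
  split.
  + by rewrite /= iE addn1.
  + by rewrite in_y_advance -yE.
  + by rewrite -cellE'; case: (gr i) => [[] []].
- by move=> j' t pad_t lt; rewrite -tab.
- move=> l; rewrite ltnS leq_eqVlt /= iE => /predU1P[->|lt_l].
    by rewrite eqxx.
  by rewrite (ltn_eqF lt_l); apply: outE.
- by [].
Qed.

Lemma trace_stop s : tracing n s -> ~~ beval s trace_guard.
Proof.
by move=> [[[[nE _ _ _] _] _ _] [iE _ _] _ _ _]; rewrite /= iE nE addn1 ltnn.
Qed.

(** * Total running time, and the solution of the robust problem *)

Definition program_time :=
  (time_bound (setup_cmd K_exp L_exp)
   + ((n + n).+1 * ((bcost cast_guard).+1 + time_bound cast_body)
        + (bcost cast_guard).+1
   + (n.+1 * stride_row
        * ((bcost table_guard).+1 + time_bound (table_body excess))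
        + (bcost table_guard).+1
   + (time_bound rewind_cmd
   + (n * ((bcost trace_guard).+1 + time_bound trace_body)
        + (bcost trace_guard).+1)))))%N.

Lemma programP :
  triple (eq s0) (program K_exp L_exp excess) program_time (tracing n).
Proof.
apply: triple_seq; first by apply: triple_run => // _ <-; apply: setup_cmdP.
apply: triple_seq.
  by apply: triple_while => //; [apply: cast_step | apply: cast_stop].
apply: triple_seq.
  move=> s /casting_sweeping; move: s.
  by apply: triple_while => //; [apply: sweep_step | apply: sweep_stop].
apply: triple_seq; first by apply: triple_run => //; apply: rewind_cmdP.
by apply: triple_while => //; [apply: trace_step | apply: trace_stop].
Qed.

Lemma program_time_le Q : (0 < n)%N -> (n <= Q)%N ->
  (n.+1 * stride_row <= 54 * Q)%N ->
  (program_time <= time_factor K_exp L_exp excess * Q)%N.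
Proof.
move=> n_gt0 le_nQ le_SQ; rewrite /program_time.
have Q_gt0 : (0 < Q)%N by apply: leq_trans le_nQ.
(* The command costs become variables, in which the bound is linear; each one-time cost is at most
   [Q] times itself. *)
have weighted N1 N2 N3 s r x1 x2 x3 y1 y2 y3 :
    (N1 <= 3 * Q)%N -> (N2 <= 54 * Q)%N -> (N3 <= Q)%N ->
    (s + (N1 * x1 + y1 + (N2 * x2 + y2 + (r + (N3 * x3 + y3))))
     <= (s + 3 * x1 + y1 + 54 * x2 + y2 + r + x3 + y3) * Q)%N.
  move=> /(leq_mul (leqnn x1)) h1 /(leq_mul (leqnn x2)) h2 /(leq_mul (leqnn x3)) h3.
  have base x : (x <= x * Q)%N by rewrite leq_pmulr.
  have := base s; have := base r; have := base y1; have := base y2; have := base y3.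
  by lia.
by apply: weighted => //; lia.
Qed.

Lemma state_after_ext Z Z' i : (forall l, (l < i)%N -> Z l = Z' l) ->
  state_after Z i = state_after Z' i.
Proof.
elim: i => //= i IH eqZ; rewrite eqZ // IH // => l lt_li.
by rewrite eqZ // leqW.
Qed.

(** The feasible set enters only through the final counts, and the uncertainty set only through its
    position between the discrete and the continuous one. *)
Lemma program_solves (R : realType) (U : set {ffun 'I_n -> R})
    (F : {set binvec n * binvec n}) Q :
  sorted_deviations I ->
  (forall delta, U delta -> con_car I delta) ->
  (forall delta, dis_car I delta -> U delta) ->
  (forall xy, (xy \in F) = in_box K L (state_after (items xy) n)
                           && final (state_after (items xy) n)) ->
  (0 < n)%N -> (n <= Q)%N -> (n.+1 * stride_row <= 54 * Q)%N ->
  solves_within (program K_exp L_exp excess) I params F U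
    (time_factor K_exp L_exp excess * Q).
Proof.
move=> dev_sorted U_con U_dis F_E n_gt0 le_nQ le_SQ.
have [t [s [exec_t le_t [_ _ _ outE valE]]]] := programP (erefl s0).
pose xy : binvec n * binvec n :=
  ([ffun i : 'I_n => (gr i).1], [ffun i : 'I_n => (gr i).2]).
have itemsE l : (l < n)%N -> items xy l = gr l.
  move=> lt_l; rewrite -[l]/(val (Ordinal lt_l)) items_ord !ffunE.
  by case: (gr _).
have [gr_box gr_fin gr_cost] := greedy_optimal C_ge0 c_ge0 d_ge0 optimum_lt_big.
have stE i : (i <= n)%N -> state_after (items xy) i = state_after gr i.
  move=> le_in; apply: state_after_ext => l lt_l.
  exact: itemsE (leq_trans lt_l le_in).
have costE : selection_cost I xy = W n (0, 0, 0)%N.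
  rewrite -[RHS]gr_cost; apply: eq_bigr => i _.
  by rewrite stE ?itemsE // ltnW.
exists t, s, xy, (W n (0, 0, 0)%N); split=> //.
- exact: leq_trans le_t (program_time_le n_gt0 le_nQ le_SQ).
- by split=> // i; rewrite ffunE; case: (outE i (ltn_ord i)).
rewrite -costE; apply: optimal_selection => //.
  by rewrite F_E stE // gr_box.
move=> xy'; rewrite F_E costE => /andP[box' fin'].
exact: cost_to_go_lower_bound.
Qed.

End Verification.

(** * The two feasible sets as conditions on the final counts *)

Section Instances.

Lemma state_after_items n (xy : binvec n * binvec n) :
  let s := state_after (items xy) n in
  [/\ s.1.1 + s.2 = \sum_i xy.1 i, s.1.2 + s.2 = \sum_i xy.2 i
    & s.2 = \sum_i xy.1 i * xy.2 i]%N.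
Proof.
have H i (Z := items xy) : let s := state_after Z i in
    [/\ s.1.1 + s.2 = \sum_(l < i) (Z l).1, s.1.2 + s.2 = \sum_(l < i) (Z l).2
      & s.2 = \sum_(l < i) (Z l).1 * (Z l).2]%N.
  elim: i => [|i [IH1 IH2 IH3]]; first by rewrite !big_ord0.
  rewrite !big_ord_recr /= -IH1 -IH2 -IH3.
  by case: (Z i) => [[] []]; split; rewrite /=; lia.
have [h1 h2 h3] := H n.
by split; [rewrite h1|rewrite h2|rewrite h3]; apply: eq_bigr => i _;
  rewrite items_ord.
Qed.

(** This is the distance |a + b - p|, written as the sum of both truncated differences. *)
Definition excess_p :=
  IAdd (ISub (IAdd (IVar v_a) (IVar v_b)) (IVar 1))
       (ISub (IVar 1) (IAdd (IVar v_a) (IVar v_b))).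

Definition excess_pk :=
  IAdd (IAdd (ISub (IAdd (IVar v_a) (IVar v_e)) (IVar 1))
             (ISub (IVar 1) (IAdd (IVar v_a) (IVar v_e))))
       (IAdd (ISub (IAdd (IVar v_b) (IVar v_e)) (IVar 1))
             (ISub (IVar 1) (IAdd (IVar v_b) (IVar v_e)))).

Lemma solvable_p_between (R : realType)
    (U : forall n, instance n -> set {ffun 'I_n -> R}) :
  (forall n (I : instance n) delta, U n I delta -> con_car I delta) ->
  (forall n (I : instance n) delta, dis_car I delta -> U n I delta) ->
  solvable_p U (fun n p => n * p ^ 2)%N.
Proof.
move=> U_con U_dis; exists (program (IVar 1) (ICst 0) excess_p).
exists (time_factor (IVar 1) (ICst 0) excess_p).
move=> n p I /andP[p_gt0 le_pn] dev_sorted.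
have n_gt0 : (0 < n)%N by apply: leq_trans le_pn.
have p2_gt0 : (0 < p ^ 2)%N by rewrite expn_gt0 p_gt0.
apply: (@program_solves _ _ _ _ _ _ p 0
  (fun s => s.1.1 + s.1.2 == p)%N) => //.
- by move=> s /= ->; apply/idP/eqP; lia.
- by lia.
(* Feasible selection: the first p items, in x only. *)
- exists (fun l => ((l < p)%N, false)).
  have -> : state_after (fun l => ((l < p)%N, false)) n = (p, 0, 0)%N.
    have H i : state_after (fun l => ((l < p)%N, false)) i = (minn i p, 0, 0)%N.
      elim: i => [|i /= ->]; rewrite ?min0n // /advance /= !andbF !andbT.
      by congr (_, _, _); lia.
    by rewrite H (minn_idPr le_pn).
  by rewrite /in_box /= addn0 eqxx leqnn.
- exact: U_con.
- exact: U_dis.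
- move=> xy; rewrite inE big_split /=.
  have [<- <- <-] := state_after_items xy.
  by rewrite /in_box; apply/andP/andP; move=> []; lia.
- by rewrite leq_pmulr.
rewrite /stride_row /stride_a /stride_b -mulnn; nia.
Qed.

Lemma solvable_pk_between (R : realType)
    (U : forall n, instance n -> set {ffun 'I_n -> R}) :
  (forall n (I : instance n) delta, U n I delta -> con_car I delta) ->
  (forall n (I : instance n) delta, dis_car I delta -> U n I delta) ->
  solvable_pk U (fun n p k => n * k ^ 2 * p)%N.
Proof.
move=> U_con U_dis; exists (program (IVar 2) (IVar 1) excess_pk).
exists (time_factor (IVar 2) (IVar 1) excess_pk).
move=> n p k I k_gt0 /andP[le_kp le_pn] dev_sorted.
have p_gt0 : (0 < p)%N by apply: leq_trans le_kp.
have n_gt0 : (0 < n)%N by apply: leq_trans le_pn.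
have k2p_gt0 : (0 < k ^ 2 * p)%N by rewrite muln_gt0 expn_gt0 k_gt0.
apply: (@program_solves _ _ _ _ _ _ k p
  (fun s => (s.1.1 + s.2 == p) && (s.1.2 + s.2 == p))%N) => //.
- by move=> s /= ->; apply/idP/andP => [?|[/eqP ? /eqP ?]]; [split; apply/eqP|]; lia.
- by lia.
(* Feasible selection: the first p items, in both x and y. *)
- exists (fun l => ((l < p)%N, (l < p)%N)).
  have -> : state_after (fun l => ((l < p)%N, (l < p)%N)) n = (0, 0, p)%N.
    have H i : state_after (fun l => ((l < p)%N, (l < p)%N)) i = (0, 0, minn i p)%N.
      elim: i => [|i /= ->]; rewrite ?min0n // /advance /= andbN andNb andbb.
      by congr (_, _, _); lia.
    by rewrite H (minn_idPr le_pn).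
  by rewrite /in_box /= add0n eqxx leqnn.
- exact: U_con.
- exact: U_dis.
- move=> xy; rewrite inE.
  have [<- <- <-] := state_after_items xy.
  (* Given a + e = b + e = p, the overlap condition e >= p - k says exactly that a <= k and b <=
     k. *)
  rewrite /in_box; apply/and3P/andP.
    move=> [/eqP ? /eqP ? ?]; split; first by apply/and3P; split; lia.
    by apply/andP; split; apply/eqP; lia.
  by move=> [/and3P[? ? ?] /andP[/eqP ? /eqP ?]]; split; [apply/eqP|apply/eqP|]; lia.
- by rewrite -mulnA leq_pmulr.
rewrite /stride_row /stride_a /stride_b -mulnn; nia.
Qed.

End Instances.

Lemma dis_car_con_car (R : realType) n (I : instance n)
    (delta : {ffun 'I_n -> R}) : dis_car I delta -> con_car I delta.
Proof.
move=> [d_val bud]; split=> // i.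
have d_ge0 : 0 <= ratr (deviation I i) :> R by rewrite ler0q deviation_ge0.
by case: (d_val i) => ->; rewrite ?d_ge0 lexx ?d_ge0.
Qed.

Theorem theorem1 (R : realType) :
  [/\ solvable_p (@con_car R) (fun n p => n * p ^ 2)%N,
      solvable_p (@dis_car R) (fun n p => n * p ^ 2)%N,
      solvable_pk (@con_car R) (fun n p k => n * k ^ 2 * p)%N
    & solvable_pk (@dis_car R) (fun n p k => n * k ^ 2 * p)%N].
Proof.
split; [apply: solvable_p_between | apply: solvable_p_between
  | apply: solvable_pk_between | apply: solvable_pk_between] => // n I delta.
all: exact: dis_car_con_car.
Qed.
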